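(* Let $n\ge3$, let $H\subseteq\mathbb{C}^n$ be an additive subgroup containing $t_1=(1-n,0,\ldots,0)$, and assume that $H_1=\{h=(h_1,\ldots,h_n)\in H:h_1=1\}$ contains $n$ vectors that are linearly independent over $\mathbb{C}$. Then the $n$-Lie algebra $E(H)$ is isomorphic to an $n$-Lie algebra of $W$-type; that is, there exist a commutative associative complex algebra $A$ and an $(n-1)$-dimensional Lie algebra $\mathfrak g\subseteq\operatorname{Der}A$ such that $A$ is $\mathfrak g$-simple and $E(H)\cong W(A,\mathfrak g)$ as $n$-Lie algebras.
   Context: All vector spaces are over $\mathbb{C}$. An $n$-Lie algebra is a vector space $L$ with an alternating $n$-linear bracket satisfying $[x_1,\ldots,x_{n-1},[y_1,\ldots,y_n]]=\sum_{i=1}^n[y_1,\ldots,[x_1,\ldots,x_{n-1},y_i],\ldots,y_n]$. $E(H)=\bigoplus_{a\in H_1}\mathbb{C}e_a$ with bracket $[e_{a_1},\ldots,e_{a_n}]=\det(a_1,\ldots,a_n)\,e_{a_1+\cdots+a_n+t_1}$ (known, by Pozhidaev, to be a central simple $n$-Lie algebra). For a commutative associative algebra $A$ and a Lie algebra $\mathfrak g\subseteq\operatorname{Der}A$, $A$ is $\mathfrak g$-simple if it has no nonzero proper associative ideal invariant under every element of $\mathfrak g$. If $\dim\mathfrak g=n-1$ and $D_1,\ldots,D_{n-1}$ is a basis of $\mathfrak g$, then $W(A,\mathfrak g)$ is the vector space $A$ with bracket $[f_1,\ldots,f_n]_W$ equal to the determinant of the $n\times n$ matrix whose first row is $(f_1,\ldots,f_n)$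 and whose $(i+1)$-st row is $(D_i(f_1),\ldots,D_i(f_n))$, $1\le i\le n-1$. *)

(* Defs.v *)
From HB Require Import structures.
From mathcomp Require Import all_boot all_order all_algebra.
From mathcomp Require Import perm.
From mathcomp Require Import boolp classical_sets reals.
From mathcomp Require Import complex finmap monalg.

Set Implicit Arguments.
Unset Strict Implicit.
Unset Printing Implicit Defensive.

Import GRing.Theory Num.Theory.

Local Open Scope ring_scope.

(* Throughout, the arity n of the brackets is m.+1, so m = n - 1. *)

Definition upd (T : Type) (n : nat) (x : 'I_n -> T) (i : 'I_n) (u : T)
  : 'I_n -> T := fun j => if j == i then u else x j.

(* (x_1, ..., x_m, z) *)
Definition snoc (T : Type) (m : nat) (x : 'I_m -> T) (z : T) : 'I_m.+1 -> T :=
  fun i => oapp x z (unlift ord_max i).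

Definition multilinear (K : fieldType) (L L' : lmodType K) (n : nat)
    (b : ('I_n -> L) -> L') : Prop :=
  forall x i, linear_for *:%R (fun u => b (upd x i u)).

Definition alternating (L L' : nmodType) (n : nat)
    (b : ('I_n -> L) -> L') : Prop :=
  forall x i j, i != j -> x i = x j -> b x = 0.

Record nLie_axioms (K : fieldType) (m : nat) (L : lmodType K)
    (b : ('I_m.+1 -> L) -> L) : Prop := {
  nLie_multilinear : multilinear b;
  nLie_alternating : alternating b;
  nLie_identity : forall (x : 'I_m -> L) (y : 'I_m.+1 -> L),
    b (snoc x (b y)) = \sum_(i < m.+1) b (upd y i (b (snoc x (y i))))
}.

Record nLieAlg (K : fieldType) (m : nat) := NLieAlg {
  nLie_space :> lmodType K;
  nLie_bracket : ('I_m.+1 -> nLie_space) -> nLie_space;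
  nLie_ax : nLie_axioms nLie_bracket
}.

Definition nLie_isomorphic (K : fieldType) (m : nat) (L L' : nLieAlg K m)
    : Prop :=
  exists phi : {linear L -> L'}, bijective phi /\
    forall x : 'I_m.+1 -> L, phi (nLie_bracket x) = nLie_bracket (phi \o x).

Section Determinants.
Variable (R : comNzRingType).

Definition set_row (n : nat) (M : 'M[R]_n) (i : 'I_n) (v : 'I_n -> R) : 'M[R]_n :=
  \matrix_(j, k) if j == i then v k else M j k.

Lemma det_set_row (n : nat) (M : 'M[R]_n) i v :
  \det (set_row M i v) = \sum_k v k * cofactor M i k.
Proof.
rewrite (expand_det_row _ i); apply: eq_bigr => k _; rewrite mxE eqxx.
congr (_ * (_ * \det _)); apply/matrixP => a b; rewrite !mxE.
by rewrite lift_eqF.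
Qed.

Lemma set_row_id (n : nat) (M : 'M[R]_n) i : M = set_row M i (M i).
Proof. by apply/matrixP => j k; rewrite mxE; case: eqP => // ->. Qed.

Lemma sum_det_set_row (n : nat) (M B : 'M[R]_n) :
  \sum_i \sum_k (M *m B) i k * cofactor M i k = \tr B * \det M.
Proof.
transitivity (\tr (M *m B *m \adj M)).
  by apply: eq_bigr => i _; rewrite mxE; apply: eq_bigr => k _; rewrite !mxE.
by rewrite mxtrace_mulC mulmxA mul_adj_mx mul_scalar_mx mxtraceZ mulrC.
Qed.

Lemma sum_cofactor_col (n : nat) (M : 'M[R]_n) k l :
  \sum_j M j l * cofactor M j k = \det M *+ (k == l).
Proof.
have := congr1 (fun N : 'M_n => N k l) (mul_adj_mx M); rewrite !mxE => <-.
by apply: eq_bigr => j _; rewrite !mxE mulrC.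
Qed.

Lemma sum_det_cofactor (n : nat) (M : 'M[R]_n) :
  \sum_j \sum_l M j l * cofactor M j l = \det M *+ n.
Proof.
transitivity (\sum_(j < n) \det M); last by rewrite sumr_const card_ord.
by apply: eq_bigr => j _; rewrite (expand_det_row _ j).
Qed.

Variable (d : R -> R).
Hypothesis (dD : {morph d : u v / u + v}) (d1 : d 1 = 0)
  (dM : forall u v, d (u * v) = d u * v + u * d v).

Lemma derZ0 : d 0 = 0.
Proof. by apply: (addIr (d 0)); rewrite -dD !add0r. Qed.

Lemma derN u : d (- u) = - d u.
Proof. by apply: (addIr (d u)); rewrite -dD !addNr derZ0. Qed.

Lemma der_sum (I : Type) (r : seq I) (P : pred I) (F : I -> R) :
  d (\sum_(i <- r | P i) F i) = \sum_(i <- r | P i) d (F i).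
Proof. exact: (big_morph d dD derZ0). Qed.

Lemma der_sign k : d ((-1) ^+ k) = 0.
Proof.
elim: k => [|k IH]; first by rewrite expr0.
by rewrite exprS dM IH mulr0 addr0 derN d1 oppr0 mul0r.
Qed.

Lemma der_prod (n : nat) (F : 'I_n -> R) :
  d (\prod_i F i) = \sum_j \prod_i (if i == j then d (F i) else F i).
Proof.
elim: n F => [|n IH] F; first by rewrite !big_ord0 d1.
rewrite big_ord_recl dM IH [in RHS]big_ord_recl; congr (_ + _).
  rewrite [in RHS]big_ord_recl eqxx; congr (_ * _).
rewrite mulr_sumr; apply: eq_bigr => j _.
rewrite [in RHS]big_ord_recl (negbTE (neq_lift _ _)); congr (_ * _).
Qed.

Lemma der_det (n : nat) (M : 'M[R]_n) :
  d (\det M) = \sum_j \det (set_row M j (fun k => d (M j k))).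
Proof.
rewrite /determinant der_sum exchange_big; apply: eq_bigr => s _.
rewrite dM der_sign mul0r add0r der_prod mulr_sumr; apply: eq_bigr => j _.
by congr (_ * _); apply: eq_bigr => i _; rewrite mxE; case: eqP => // ->.
Qed.

Lemma der_det_cofactor (n : nat) (M : 'M[R]_n) :
  d (\det M) = \sum_j \sum_k d (M j k) * cofactor M j k.
Proof. by rewrite der_det; apply: eq_bigr => j _; rewrite det_set_row. Qed.

End Determinants.

Section WType.
Variables (K : numFieldType) (A : comAlgType K).

Definition derivation (d : A -> A) : Prop :=
  linear_for *:%R d /\ forall u v, d (u * v) = d u * v + u * d v.

Record is_lie_subalgebra_Der (g : set (A -> A)) : Prop := {
  lieDer_der : forall d, g d -> derivation d;
  lieDer_0 : g (fun _ => 0);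
  lieDer_lin : forall (a : K) d d', g d -> g d' -> g (fun u => a *: d u + d' u);
  lieDer_bracket : forall d d', g d -> g d' -> g (fun u => d (d' u) - d' (d u))
}.

Record is_basis_of (m : nat) (g : set (A -> A)) (D : 'I_m -> A -> A) : Prop := {
  basis_in : forall i, g (D i);
  basis_free : forall c : 'I_m -> K,
    (forall u, \sum_i c i *: D i u = 0) -> forall i, c i = 0;
  basis_span : forall d, g d ->
    exists c : 'I_m -> K, forall u, d u = \sum_i c i *: D i u
}.

Record is_ideal (I : set A) : Prop := {
  ideal_0 : I 0;
  ideal_lin : forall (a : K) u v, I u -> I v -> I (a *: u + v);
  ideal_mul : forall u v, I v -> I (u * v)
}.

Definition g_simple (g : set (A -> A)) : Prop :=
  forall I : set A, is_ideal I ->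
    (forall d u, g d -> I u -> I (d u)) ->
    (forall u, I u -> u = 0) \/ (forall u, I u).

(* The column (u, D_1 u, ..., D_m u) *)
Definition jet (m : nat) (D : 'I_m -> A -> A) (u : A) (k : 'I_m.+1) : A :=
  oapp (fun i => D i u) u (unlift ord0 k).

(* The first row of the matrix is (f_1, ..., f_n), the next ones are
   (D_i f_1, ..., D_i f_n). *)
Definition W_bracket (m : nat) (D : 'I_m -> A -> A) (f : 'I_m.+1 -> A) : A :=
  \det (\matrix_(k, j) jet D (f j) k).

Section WnLie.
Variables (m : nat) (g : set (A -> A)) (D : 'I_m -> A -> A).
Hypotheses (hg : is_lie_subalgebra_Der g) (hD : is_basis_of g D).

Let M (f : 'I_m.+1 -> A) : 'M[A]_m.+1 := \matrix_(j, k) jet D (f j) k.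

Let D_lin i : linear_for *:%R (D i).
Proof. by case: (lieDer_der hg (basis_in hD i)). Qed.

Let D_mul i u v : D i (u * v) = D i u * v + u * D i v.
Proof. by case: (lieDer_der hg (basis_in hD i)). Qed.

Let D_add i : {morph D i : u v / u + v}.
Proof. by move=> u v; have := D_lin i 1 u v; rewrite /= !scale1r. Qed.

Let D_0 i : D i 0 = 0. Proof. exact: derZ0 (D_add i). Qed.

Let D_1 i : D i 1 = 0.
Proof.
have /eqP := D_mul i 1 1.
by rewrite !mulr1 mul1r -subr_eq0 opprD addrA subrr add0r oppr_eq0 => /eqP.
Qed.

Let D_sum i (I : Type) (r : seq I) (P : pred I) (F : I -> A) :
  D i (\sum_(j <- r | P j) F j) = \sum_(j <- r | P j) D i (F j).
Proof. exact: der_sum (D_add i) _ _ _ _. Qed.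

Let jet0 u : jet D u ord0 = u.
Proof. by rewrite /jet unlift_none. Qed.

Let jetS u l : jet D u (lift ord0 l) = D l u.
Proof. by rewrite /jet liftK. Qed.

Let jet_lin a u v k : jet D (a *: u + v) k = a *: jet D u k + jet D v k.
Proof. by rewrite /jet; case: unliftP => [j _|_] //=; rewrite D_lin. Qed.

Let WE f : W_bracket D f = \det (M f).
Proof. by rewrite -det_tr; congr (\det _); apply/matrixP=> i j; rewrite !mxE. Qed.

Let W_upd f i u :
  W_bracket D (upd f i u) = \sum_k jet D u k * cofactor (M f) i k.
Proof.
rewrite WE -det_set_row; congr (\det _); apply/matrixP => j k; rewrite !mxE /upd.
by case: eqP.
Qed.

Lemma W_multilinear : multilinear (W_bracket D).
Proof.
move=> f i a u v /=; rewrite !W_upd scaler_sumr -big_split /=.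
by apply: eq_bigr => k _; rewrite jet_lin mulrDl scalerAl.
Qed.

Lemma W_alternating : alternating (W_bracket D).
Proof.
move=> f i j ij fij; rewrite WE; apply: (determinant_alternate ij) => k.
by rewrite !mxE fij.
Qed.

Section Identity.
Variable (G : 'I_m -> 'I_m -> 'I_m -> K).
Hypothesis (HG : forall l q u,
  D l (D q u) - D q (D l u) = \sum_p G l q p *: D p u).

Let G_anti l q p : G l q p = - G q l p.
Proof.
apply/eqP; rewrite -subr_eq0 opprK; apply/eqP.
apply: (basis_free hD (c := fun p => G l q p + G q l p)) => u.
transitivity (\sum_i G l q i *: D i u + \sum_i G q l i *: D i u).
  by rewrite -big_split; apply: eq_bigr => i _; rewrite scalerDl.
by rewrite -!HG addrC subrKA subrr.
Qed.

Variable (x : 'I_m -> A).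

Let c k := cofactor (M (snoc x 0)) ord_max k.
Let s (l : 'I_m) : 'I_m.+1 := lift ord0 l.

Let W_snoc z : W_bracket D (snoc x z) = \sum_k jet D z k * c k.
Proof.
rewrite WE -det_set_row; congr (\det _); apply/matrixP => j k; rewrite !mxE /snoc.
by case: unliftP => [i ->|->] /=; rewrite ?eqxx // eq_sym (negbTE (neq_lift _ _)).
Qed.

(* c_l is the determinant of Nt l; row k of Nt l is (D_k x_1, ..., D_k x_m, [k = l]) *)
Let Nt l : 'M[A]_m.+1 :=
  \matrix_(k, b) snoc (fun i => jet D (x i) k) (k == l)%:R b.

Let cE l : c l = \det (Nt l).
Proof.
rewrite -det_tr; transitivity
  (\det (set_row (M (snoc x 0)) ord_max (fun k => (k == l)%:R))).
  rewrite det_set_row (bigD1 l) //= eqxx mul1r big1 ?addr0 // => k kl.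
  by rewrite (negbTE kl) mul0r.
congr (\det _); apply/matrixP => j k; rewrite !mxE /snoc.
by case: unliftP => [i ->|->] /=; rewrite ?eqxx // eq_sym (negbTE (neq_lift _ _)).
Qed.

Let F l p (u : 'I_m -> A) := \det (set_row (Nt l) p (snoc u 0)).

Let det_col0 (N : 'M[A]_m.+1) : (forall i, N i ord_max = 0) -> \det N = 0.
Proof.
by move=> N0; rewrite (expand_det_col _ ord_max) big1 // => i _; rewrite N0 mul0r.
Qed.

Let snoc_max (u : 'I_m -> A) z : snoc u z ord_max = z.
Proof. by rewrite /snoc unlift_none. Qed.

Let Fll l u : F l l u = 0.
Proof.
by apply: det_col0 => i; rewrite !mxE !snoc_max; case: eqP => // /eqP/negbTE->.
Qed.

Let F_sum (I : finType) l p (a : I -> K) (u : I -> 'I_m -> A) :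
  F l p (fun b => \sum_i a i *: u i b) = \sum_i a i *: F l p (u i).
Proof.
rewrite /F det_set_row; under [RHS]eq_bigr => i _ do rewrite det_set_row scaler_sumr.
rewrite exchange_big; apply: eq_bigr => k _ /=.
rewrite (_ : snoc _ 0 k = \sum_i a i *: snoc (u i) 0 k).
  by rewrite mulr_suml; apply: eq_bigr => i _; rewrite scalerAl.
rewrite /snoc; case: unliftP => //= _.
by rewrite big1 // => i _; rewrite scaler0.
Qed.

Let F_add l p (u v : 'I_m -> A) :
  F l p (fun b => u b + v b) = F l p u + F l p v.
Proof.
rewrite /F !det_set_row -big_split; apply: eq_bigr => k _ /=.
by rewrite -mulrDl /snoc; case: unliftP => //= _; rewrite addr0.
Qed.

Let F_ext l p u v : (forall b, u b = v b) -> F l p u = F l p v.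
Proof. by move=> uv; congr F; apply: funext. Qed.

Let F_anti l p u : F l p u = - F p l u.
Proof.
have [<-|lp] := eqVneq l p; first by rewrite Fll oppr0.
pose S := set_row (Nt p) l (snoc u 0).
have -> : - F p l u = \det (xrow l p S).
  rewrite /xrow row_permE det_mulmx det_perm odd_tperm lp expr1 mulN1r.
  by [].
pose T := set_row (Nt l) p (snoc u 0).
apply/eqP; rewrite -subr_eq0 /F -/T; apply/eqP.
have -> : xrow l p S = set_row T l (S p).
  apply/matrixP => j k; rewrite !mxE; case: tpermP => [->|->|].
  - by rewrite !eqxx.
  - by rewrite [p == l]eq_sym (negbTE lp) !eqxx.
  by move=> /eqP jl /eqP jp; rewrite (negbTE jl) (negbTE jp).
rewrite {1}(set_row_id T l) !det_set_row -sumrB.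
under eq_bigr => k _ do rewrite -mulrBl.
rewrite -(det_set_row T l (fun k => T l k - S p k)); apply: det_col0 => j.
rewrite !mxE !snoc_max !eqxx (negbTE lp) [p == l]eq_sym (negbTE lp).
by case: ifP => [_|->]; rewrite ?subrr //; case: ifP.
Qed.

Let F_jet l p q :
  F l p (fun b => jet D (x b) q) = (q == p)%:R * c l - (q == l)%:R * c p.
Proof.
have Fd a b : a != b -> F a b (fun i => jet D (x i) b) = c a.
  move=> ab; rewrite cE; congr (\det _); apply/matrixP => j k; rewrite !mxE.
  case: eqP => // ->; rewrite /snoc; case: unliftP => //= _.
  by rewrite eq_sym (negbTE ab).
have [<-|lp] := eqVneq l p; first by rewrite Fll subrr.
have [->|qp] := eqVneq q p.
  by rewrite Fd // eq_sym (negbTE lp) mul1r mul0r subr0.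
have [->|ql] := eqVneq q l.
  by rewrite F_anti Fd 1?eq_sym // mul0r mul1r sub0r.
rewrite !mul0r subr0; apply: (determinant_alternate qp) => k.
by rewrite !mxE eqxx (negbTE qp) (negbTE ql).
Qed.

Let D_c l k : D l (c k) = \sum_p F k p (fun b => D l (jet D (x b) p)).
Proof.
rewrite cE (der_det (D_add l) (D_1 l) (D_mul l)); apply: eq_bigr => p _.
congr (\det _); apply/matrixP => i b; rewrite !mxE; case: eqP => // _.
rewrite /snoc; case: unliftP => //= _.
by case: (_ == _); rewrite /= ?D_1 ?D_0.
Qed.

Let div_c :
  \sum_l (D l (c (s l)) + \sum_q G l q l *: c (s q)) = - (c ord0 *+ m).
Proof.
pose T := \sum_l \sum_q F (s l) (s q) (fun b => D l (D q (x b))).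
have Ec : \sum_l D l (c (s l)) = - (c ord0 *+ m) + T.
  rewrite -mulNrn -[m in _ *+ m]card_ord -sumr_const /T -big_split.
  apply: eq_bigr => l _; rewrite D_c big_ord_recl; congr (_ + _).
    transitivity (F (s l) ord0 (fun b => jet D (x b) (s l))).
      by apply: F_ext => b; rewrite jet0 jetS.
    by rewrite F_jet eqxx mul0r mul1r sub0r.
  by apply: eq_bigr => q _; apply: F_ext => b; rewrite jetS.
pose U := \sum_l \sum_q G l q l *: c (s q).
rewrite big_split /= Ec -/U -addrA.
suff : T *+ 2 = - U *+ 2.
  move/eqP; rewrite -subr_eq0 -mulrnBl opprK -scaler_nat scaler_eq0 pnatr_eq0 /=.
  by move/eqP ->; rewrite addr0.
have T2 : T *+ 2 = \sum_l \sum_q (G l q q *: c (s l) - G l q l *: c (s q)).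
  rewrite mulr2n {2}/T exchange_big /T -big_split; apply: eq_bigr => l _.
  rewrite -big_split; apply: eq_bigr => q _ /=.
  rewrite [X in _ + X]F_anti.
  have -> : - F (s l) (s q) (fun b => D q (D l (x b))) =
            F (s l) (s q) (fun b => - D q (D l (x b))).
    apply/eqP; rewrite eq_sym -subr_eq0 opprK -F_add.
    rewrite (F_ext _ _ (v := fun b => \sum_(i : 'I_0) 0 *: 0)) ?F_sum.
      by rewrite big_ord0.
    by move=> b; rewrite addNr big_ord0.
  rewrite -F_add (F_ext _ _ (v := fun b => \sum_p G l q p *: jet D (x b) (s p))).
    rewrite F_sum.
    under eq_bigr => p _ do rewrite F_jet !(inj_eq lift_inj) scalerBr.
    rewrite sumrB (bigD1 q) //= eqxx mul1r big1 ?addr0 => [|p pq]; last first.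
      by rewrite (negbTE pq) mul0r scaler0.
    rewrite (bigD1 l) //= eqxx mul1r big1 ?addr0 // => p pl.
    by rewrite (negbTE pl) mul0r scaler0.
  by move=> b; rewrite HG; apply: eq_bigr => p _; rewrite jetS.
rewrite T2; under eq_bigr => l _ do rewrite sumrB.
rewrite sumrB -/U mulr2n; congr (_ + _).
rewrite exchange_big /= /U -sumrN; apply: eq_bigr => l _.
by rewrite -sumrN; apply: eq_bigr => q _; rewrite G_anti scaleNr.
Qed.

Let B : 'M[A]_m.+1 := \matrix_(p, k)
  oapp (fun l => D l (c p) +
          oapp (fun r => \sum_q G l q r *: c (s q)) 0 (unlift ord0 p))
       0 (unlift ord0 k).

Let trB : \tr B = - (c ord0 *+ m).
Proof.
rewrite /mxtrace big_ord_recl mxE unlift_none /= add0r -div_c.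
by apply: eq_bigr => l _; rewrite mxE liftK.
Qed.

Let jet_ad z k : jet D (W_bracket D (snoc x z)) k =
  c ord0 * jet D z k + \sum_q c (s q) * D q (jet D z k)
  + \sum_p jet D z p * B p k.
Proof.
rewrite W_snoc /jet; case: unliftP => [l ->|->] /=; last first.
  rewrite big_ord_recl unlift_none mulrC [X in _ = _ + X]big1 ?addr0.
    by congr (_ + _); apply: eq_bigr => q _; rewrite liftK mulrC.
  by move=> p _; rewrite mxE unlift_none mulr0.
rewrite D_sum; under [LHS]eq_bigr => p _ do rewrite D_mul.
under [X in _ = _ + X]eq_bigr => p _ do rewrite mxE liftK /= mulrDr.
rewrite !big_split /= [LHS]addrC [RHS]addrCA; congr (_ + _).
rewrite big_ord_recl unlift_none /= [X in _ = _ + X]big_ord_recl unlift_none mulr0 add0r.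
rewrite mulrC -addrA; congr (_ + _).
under [X in _ = _ + X]eq_bigr => p _ do rewrite liftK /= mulr_sumr.
rewrite exchange_big -big_split; apply: eq_bigr => q _ /=.
rewrite liftK /=; apply/eqP; rewrite [c (s q) * _]mulrC addrC -subr_eq -mulrBl HG mulr_suml.
by apply/eqP; apply: eq_bigr => p _; rewrite -scalerAl -scalerAr.
Qed.

Lemma W_identity y : W_bracket D (snoc x (W_bracket D y)) =
  \sum_i W_bracket D (upd y i (W_bracket D (snoc x (y i)))).
Proof.
rewrite W_snoc big_ord_recl jet0 WE.
under eq_bigr => q _ do rewrite jetS (der_det_cofactor (D_add q) (D_1 q) (D_mul q)).
under [RHS]eq_bigr => j _ do rewrite W_upd.
transitivity (\sum_j \sum_k (c ord0 * (M y j k * cofactor (M y) j k)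
   + \sum_q c (s q) * (D q (M y j k) * cofactor (M y) j k)
   + (M y *m B) j k * cofactor (M y) j k)); last first.
  apply: eq_bigr => j _; apply: eq_bigr => k _; rewrite jet_ad !mulrDl.
  have Mjk i : M y j i = jet D (y j) i by rewrite mxE.
  congr (_ + _ + _); first by rewrite Mjk mulrA.
    by rewrite mulr_suml; apply: eq_bigr => q _; rewrite Mjk mulrA.
  by congr (_ * _); rewrite mxE; apply: eq_bigr => p _; rewrite Mjk.
under [RHS]eq_bigr => j _ do rewrite !big_split /= -mulr_sumr.
rewrite !big_split /= -mulr_sumr sum_det_cofactor sum_det_set_row trB.
rewrite mulNr mulrnAl mulrnAr mulrS addrAC -!addrA; congr (_ + _); first by rewrite mulrC.
rewrite addrA subrr add0r.
under eq_bigr => q _ do rewrite mulrC mulr_sumr.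
rewrite exchange_big; apply: eq_bigr => j _ /=.
under eq_bigr => q _ do rewrite mulr_sumr.
by rewrite exchange_big.
Qed.

End Identity.

Lemma W_axioms : nLie_axioms (W_bracket D).
Proof.
split; [exact: W_multilinear|exact: W_alternating|move=> x y].
have /choice[G HG] (lq : 'I_m * 'I_m) : exists a : 'I_m -> K,
    forall u, D lq.1 (D lq.2 u) - D lq.2 (D lq.1 u) = \sum_p a p *: D p u.
  by apply: (basis_span hD); apply: (lieDer_bracket hg); apply: (basis_in hD).
by apply: (W_identity (G := fun l q => G (l, q))) => l q u; apply: (HG (l, q)).
Qed.

End WnLie.

Definition W (m : nat) (g : set (A -> A)) (hg : is_lie_subalgebra_Der g)
    (D : 'I_m -> A -> A) (hD : is_basis_of g D) : nLieAlg K m :=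
  NLieAlg (W_axioms hg hD).

End WType.

Section MultilinearExtension.
Variables (K : fieldType) (I : choiceType) (L : lmodType K) (n : nat).
Variable (phi : ('I_n -> I) -> L).

(* {malg K[I]} has basis << a >>, a in I; every a contributing to the sum takes
   its values in the union of the supports of the x_i. *)
Definition multilinear_extension (x : 'I_n -> {malg K[I]}) : L :=
  \sum_(a : {ffun 'I_n -> (\big[fsetU/fset0]_(i < n) msupp (x i))%fset})
    (\prod_(i < n) (x i)@_(val (a i))) *: phi (fun i => val (a i)).

Lemma multilinear_extensionE (T : {fset I}) x :
  (forall i, (msupp (x i) `<=` T)%fset) ->
  multilinear_extension x = \sum_(a : {ffun 'I_n -> T})
    (\prod_(i < n) (x i)@_(val (a i))) *: phi (fun i => val (a i)).
Proof.
move=> xT; rewrite /multilinear_extension; set S := (\big[fsetU/fset0]_(i < n) _)%fset.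
have ST k : k \in S -> k \in T.
  by move/bigfcupP => [i _ ki]; apply: (fsubsetP (xT i)).
pose h (b : {ffun 'I_n -> S}) : {ffun 'I_n -> T} :=
  [ffun i => [` ST _ (valP (b i)) ]%fset].
have h_inj : injective h.
  move=> b b' /ffunP bb'; apply/ffunP => i; have := congr1 val (bb' i).
  by rewrite !ffunE /= => /val_inj.
rewrite [RHS](bigID (mem (h @: {: {ffun _ -> _}}))) /= [X in _ = _ + X]big1 ?addr0.
  rewrite big_imset /=; last by move=> ? ? _ _; apply: h_inj.
  apply: eq_big => [b|b _]; first by [].
  congr (_ *: phi _); first by apply: eq_bigr => i _; rewrite ffunE.
  by apply: funext => i; rewrite ffunE.
move=> a ah; suff [i ai] : exists i, (x i)@_(val (a i)) = 0.
  by rewrite (bigD1 i) //= ai mul0r scale0r.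
have [/forallP aS|] := boolP [forall i, val (a i) \in S]; last first.
  rewrite negb_forall => /existsP[i ai]; exists i; apply: mcoeff_outdom.
  by apply: contra ai => ai; apply/bigfcupP; exists i; rewrite ?mem_index_enum.
case/imsetP: ah; exists [ffun i => [` aS i ]%fset] => //.
by apply/ffunP => i; apply: val_inj; rewrite !ffunE.
Qed.

Lemma multilinear_extension_multilinear : multilinear multilinear_extension.
Proof.
move=> x i c u v /=.
pose T := ((\big[fsetU/fset0]_(j < n) msupp (x j)) `|` (msupp u `|` msupp v `|` msupp (c *: u + v)))%fset.
have HT w : (msupp w `<=` T)%fset -> multilinear_extension (upd x i w) =
    \sum_(a : {ffun 'I_n -> T}) (w@_(val (a i)) *
      \prod_(j < n | j != i) (x j)@_(val (a j))) *: phi (fun i => val (a i)).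
  move=> wT; rewrite (@multilinear_extensionE T) => [|j].
    apply: eq_bigr => a _; congr (_ *: _); rewrite (bigD1 i) //= /upd eqxx.
    by congr (_ * _); apply: eq_bigr => j ji; rewrite (negbTE ji).
  rewrite /upd; case: eqP => // _; apply/fsubsetP => k kx; rewrite inE.
  by apply/orP; left; apply/bigfcupP; exists j; rewrite ?mem_index_enum.
rewrite !HT; last 3 first.
- by apply/fsubsetP => k kx; rewrite !inE kx !orbT.
- by apply/fsubsetP => k kx; rewrite !inE kx !orbT.
- by apply/fsubsetP => k kx; rewrite !inE kx !orbT.
rewrite scaler_sumr -big_split; apply: eq_bigr => a _ /=.
by rewrite mcoeffD mcoeffZ mulrDl scalerDl scalerA mulrA.
Qed.

Lemma multilinear_extension_basis (a : 'I_n -> I) :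
  multilinear_extension (fun i => << a i >>) = phi a.
Proof.
pose T : {fset I} := [fset a i | i in 'I_n]%fset.
have aT i : a i \in T by apply/imfsetP; exists i.
rewrite (@multilinear_extensionE T) => [|i]; last first.
  by apply: (fsubset_trans msuppU_le); rewrite fsub1set.
rewrite (bigD1 [ffun i => [` aT i ]%fset]) //= [X in _ + X]big1 ?addr0.
  rewrite big1 => [|i _]; last by rewrite ffunE mcoeffUU.
  by rewrite scale1r; congr phi; apply: funext => i; rewrite ffunE.
move=> b ba; suff [i bi] : exists i, a i != val (b i).
  by rewrite (bigD1 i) //= mcoeffU (negbTE bi) mul0r scale0r.
apply/existsP; apply: contraR ba; rewrite negb_exists => /forallP ab.
apply/eqP/ffunP => i; apply: val_inj; rewrite ffunE /=.
by have := ab i; rewrite negbK => /eqP.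
Qed.

End MultilinearExtension.

Section MultilinearMaps.
Variables (K : fieldType) (I : choiceType) (L L' : lmodType K).

Lemma upd_id (T : Type) n (x : 'I_n -> T) i : upd x i (x i) = x.
Proof. by apply: funext => j; rewrite /upd; case: eqP => // ->. Qed.

Lemma multilinear_ext0 n (F : ('I_n -> {malg K[I]}) -> L) : multilinear F ->
  (forall a, F (fun i => << a i >>) = 0) -> forall x, F x = 0.
Proof.
move=> Flin F0 x.
suff H k y : (forall i : 'I_n, (k <= i)%N -> exists a, y i = << a >>) -> F y = 0.
  by apply: (H n) => i; rewrite leqNgt ltn_ord.
elim: k y => [|k IH] y Hy.
  have /choice[a Ha] : forall i, exists a, y i = << a >> by move=> i; apply: Hy.
  by rewrite (_ : y = fun i => << a i >>) ?F0 //; apply: funext.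
have [kn|nk] := ltnP k n; last first.
  by apply: IH => i ki; have := leq_ltn_trans ki (ltn_ord i); rewrite ltnNge nk.
pose i0 := Ordinal kn.
have L0 a u v : F (upd y i0 (a *: u + v)) = a *: F (upd y i0 u) + F (upd y i0 v).
  exact: Flin.
have H0 : F (upd y i0 0) = 0.
  have := L0 (-1) 0 0; rewrite scaler0 addr0 scaleN1r => ->.
  by rewrite addNr.
rewrite -(upd_id y i0) [y i0]monalgE; elim: (enum_fset _) => [|a s IHs].
  by rewrite big_nil.
rewrite big_cons.
have -> : << (y i0)@_a *g a >> = (y i0)@_a *: << a >>.
  by apply/malgP => j; rewrite mcoeffZ !mcoeffU; case: eqP; rewrite ?mulr1 ?mulr0.
rewrite L0 IHs addr0 IH ?scaler0 // => i ki; rewrite /upd; case: eqP => [_|/eqP ii0].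
  by exists a.
apply: Hy; rewrite ltn_neqAle ki andbT; apply: contra ii0 => /eqP ki0.
by apply/eqP/val_inj.
Qed.

Lemma multilinear_sub n (F G : ('I_n -> L) -> L') :
  multilinear F -> multilinear G -> multilinear (fun x => F x - G x).
Proof.
move=> HF HG x i a u v; have /= -> := HF x i a u v; have /= -> := HG x i a u v.
by rewrite scalerBr opprD addrACA.
Qed.

Lemma multilinear_sum n k (F : 'I_k -> ('I_n -> L) -> L') :
  (forall j, multilinear (F j)) -> multilinear (fun x => \sum_j F j x).
Proof.
move=> HF x i a u v; rewrite scaler_sumr -big_split; apply: eq_bigr => j _.
by have /= -> := HF j x i a u v.
Qed.

Lemma multilinear_comp n (f : L' -> L') (F : ('I_n -> L) -> L') :
  linear_for *:%R f -> multilinear F -> multilinear (fun x => f (F x)).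
Proof.
by move=> Hf HF x i a u v; have /= -> := HF x i a u v; have /= -> := Hf a (F (upd x i u)).
Qed.

End MultilinearMaps.

Section NLieMalg.
Variables (K : fieldType) (I : choiceType) (m : nat).
Let L := {malg K[I]}.
Variable (b : ('I_m.+1 -> L) -> L).
Hypothesis (bM : multilinear b).

Lemma upd_upd (T : Type) n (x : 'I_n -> T) i u v : upd (upd x i u) i v = upd x i v.
Proof. by apply: funext => j; rewrite /upd; case: eqP. Qed.

Lemma upd_comm (T : Type) n (x : 'I_n -> T) i j u v : i != j ->
  upd (upd x i u) j v = upd (upd x j v) i u.
Proof.
move=> ij; apply: funext => k; rewrite /upd; case: (eqVneq k j) => // ->.
by rewrite eq_sym (negbTE ij).
Qed.

Lemma snoc_upd_max (T : Type) (x : 'I_m -> T) z z' :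
  snoc x z' = upd (snoc x z) ord_max z'.
Proof.
apply: funext => i; rewrite /upd /snoc; case: unliftP => [j ->|->] /=.
  by rewrite eq_sym (negbTE (neq_lift _ _)).
by rewrite eqxx.
Qed.

Lemma snoc_upd_lift (T : Type) (x : 'I_m -> T) z i u :
  snoc (upd x i u) z = upd (snoc x z) (lift ord_max i) u.
Proof.
apply: funext => k; rewrite /upd /snoc; case: unliftP => [j ->|->] /=.
  by rewrite (inj_eq lift_inj).
by rewrite (negbTE (neq_lift _ _)).
Qed.

Lemma nLie_identity_basis :
  (forall (x : 'I_m -> I) (y : 'I_m.+1 -> I),
    b (snoc (fun i => << x i >>) (b (fun i => << y i >>))) =
    \sum_(i < m.+1) b (upd (fun i => << y i >>) i
       (b (snoc (fun i => << x i >>) << y i >>)))) ->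
  forall (x : 'I_m -> L) (y : 'I_m.+1 -> L),
    b (snoc x (b y)) = \sum_(i < m.+1) b (upd y i (b (snoc x (y i)))).
Proof.
move=> Hb x y.
have ad_lin (z : 'I_m -> L) : linear_for *:%R (fun w => b (snoc z w)).
  by move=> a u v; rewrite (snoc_upd_max z 0 u) (snoc_upd_max z 0 v) (snoc_upd_max z 0 (_ + _)); apply: bM.
have ad_mul w : multilinear (fun z : 'I_m -> L => b (snoc z w)).
  by move=> z i a u v; rewrite !snoc_upd_lift; apply: bM.
apply/eqP; rewrite -subr_eq0; apply/eqP.
pose F z w := b (snoc z (b w)) - \sum_(i < m.+1) b (upd w i (b (snoc z (w i)))).
apply: (@multilinear_ext0 _ _ _ _ (F x)) => [|w].
  apply: multilinear_sub; first exact: multilinear_comp (ad_lin x) bM.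
  apply: multilinear_sum => i w j a u v /=.
  have [->|ij] := eqVneq i j.
    rewrite !upd_upd /upd eqxx -/(upd _ _ _); have /= -> := ad_lin x a u v.
    exact: bM.
  have E t : upd w j t i = w i by rewrite /upd (negbTE ij).
  by rewrite !E !(upd_comm _ _ _ (i := j)) 1?eq_sym //; apply: bM.
apply: (@multilinear_ext0 _ _ _ _ (fun z => F z (fun i => << w i >>))) => [|z].
  apply: multilinear_sub; first exact: ad_mul.
  apply: multilinear_sum => i.
  apply: (multilinear_comp (f := fun t => b (upd _ i t))); first exact: bM.
  exact: ad_mul.
by rewrite /F Hb subrr.
Qed.

End NLieMalg.

Section EAlgebra.
Variables (K : numFieldType) (m : nat).

Definition t1 : 'rV[K]_m.+1 :=
  \row_j (if j == ord0 then 1 - m.+1%:R else 0).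

Variable (H : zmodClosed 'rV[K]_m.+1).

Definition H1 : Type := {a : 'rV[K]_m.+1 | (a \in H) && (a 0 ord0 == 1)}.

HB.instance Definition _ := Choice.on H1.

Hypothesis (Ht1 : t1 \in H).

Lemma E_index_subproof (a : 'I_m.+1 -> H1) :
  let s := \sum_i val (a i) + t1 in (s \in H) && (s 0 ord0 == 1).
Proof.
apply/andP; split.
  by rewrite rpredD // rpred_sum // => i _; case/andP: (valP (a i)).
rewrite mxE summxE (eq_bigr (fun=> 1)) => [|i _].
  by rewrite sumr_const card_ord mxE eqxx addrC subrK.
by case/andP: (valP (a i)) => _ /eqP.
Qed.

(* a_1 + ... + a_n + t_1 *)
Definition E_index (a : 'I_m.+1 -> H1) : H1 :=
  exist _ (\sum_i val (a i) + t1) (E_index_subproof a).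

Definition rows_mx (a : 'I_m.+1 -> 'rV[K]_m.+1) : 'M[K]_m.+1 :=
  \matrix_(i, j) a i 0 j.

(* {malg K[H1]} is the direct sum of the lines K e_a, with e_a = << a >>. *)
Definition E_bracket : ('I_m.+1 -> {malg K[H1]}) -> {malg K[H1]} :=
  multilinear_extension
    (fun a => \det (rows_mx (fun i => val (a i))) *: << E_index a >>).

Lemma E_bracket_basis (a : 'I_m.+1 -> H1) :
  E_bracket (fun i => << a i >>) =
    \det (rows_mx (fun i => val (a i))) *: << E_index a >>.
Proof. exact: multilinear_extension_basis. Qed.

Let E_multilinear : multilinear E_bracket.
Proof. exact: multilinear_extension_multilinear. Qed.

Let E_alternating : alternating E_bracket.
Proof.
move=> x i j ij xij.
suff : E_bracket x *+ 2 = 0.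
  by move/eqP; rewrite -scaler_nat scaler_eq0 pnatr_eq0 /= => /eqP.
rewrite mulr2n {2}/E_bracket /multilinear_extension.
set T := (\big[fsetU/fset0]_(i < m.+1) _)%fset.
pose h (a : {ffun 'I_m.+1 -> T}) : {ffun 'I_m.+1 -> T} := [ffun k => a (tperm i j k)].
have hK : involutive h by move=> a; apply/ffunP => k; rewrite !ffunE tpermK.
rewrite (reindex_inj (inv_inj hK)) -big_split big1 //= => a _.
rewrite [X in X *: _ + _](_ : _ = \prod_k (x k)@_(val (h a k))); last first.
  rewrite [RHS](reindex_inj (inv_inj (tpermK i j))); apply: eq_bigr => k _ /=.
  by rewrite ffunE tpermK; case: tpermP => // ->; rewrite xij.
rewrite -scalerDr; apply/eqP; rewrite scaler_eq0; apply/orP; right.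
have -> : E_index (fun k => val (h a k)) = E_index (fun k => val (a k)).
  apply: val_inj => /=; congr (_ + _).
  rewrite [RHS](reindex_inj (inv_inj (tpermK i j))); apply: eq_bigr => k _ /=.
  by rewrite ffunE.
rewrite -scalerDl (_ : rows_mx (fun k => val (val (h a k))) =
    xrow i j (rows_mx (fun k => val (val (a k))))).
  by rewrite /xrow row_permE det_mulmx det_perm odd_tperm ij expr1 mulN1r addrN scale0r.
by apply/matrixP => k l; rewrite !mxE ffunE.
Qed.

Let det_upd (r : 'I_m.+1 -> 'rV[K]_m.+1) i z :
  \det (rows_mx (upd r i z)) = \sum_k z 0 k * cofactor (rows_mx r) i k.
Proof.
rewrite -det_set_row; congr (\det _); apply/matrixP => j k; rewrite !mxE /upd.
by case: eqP.
Qed.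

Let det_identity (a : 'I_m -> 'rV[K]_m.+1) (r : 'I_m.+1 -> 'rV[K]_m.+1) t :
  \det (rows_mx r) * \det (rows_mx (snoc a (\sum_i r i + t))) =
  \sum_i \det (rows_mx (snoc a (r i))) *
    \det (rows_mx (upd r i (\sum_j a j + r i + t))).
Proof.
pose c k := cofactor (rows_mx (snoc a 0)) ord_max k.
have p z : \det (rows_mx (snoc a z)) = \sum_k z 0 k * c k.
  by rewrite (snoc_upd_max a 0) det_upd.
have pD z z' : \det (rows_mx (snoc a (z + z'))) =
    \det (rows_mx (snoc a z)) + \det (rows_mx (snoc a z')).
  by rewrite !p -big_split; apply: eq_bigr => k _; rewrite mxE mulrDl.
have p0 : \det (rows_mx (snoc a 0)) = 0.
  by rewrite p big1 // => k _; rewrite mxE mul0r.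
have psum n (z : 'I_n -> _) : \det (rows_mx (snoc a (\sum_i z i))) =
    \sum_i \det (rows_mx (snoc a (z i))).
  exact: (big_morph (fun z => \det (rows_mx (snoc a z))) pD p0).
have pa : \det (rows_mx (snoc a (\sum_i a i))) = 0.
  rewrite psum big1 // => i _.
  apply: (determinant_alternate (i1 := lift ord_max i) (i2 := ord_max)) => [|k].
    by rewrite eq_sym neq_lift.
  by rewrite !mxE /snoc liftK unlift_none.
set w := \sum_j a j + t.
transitivity (\det (rows_mx r) *
    (\sum_i \det (rows_mx (snoc a (r i))) + \det (rows_mx (snoc a w)))).
  by rewrite pD psum /w pD pa add0r.
have E i : \det (rows_mx (upd r i (\sum_j a j + r i + t))) =
    \det (rows_mx r) + \sum_k w 0 k * cofactor (rows_mx r) i k.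
  rewrite det_upd (expand_det_row (rows_mx r) i) -big_split.
  apply: eq_bigr => k _ /=; rewrite -mulrDl; congr (_ * _).
  by rewrite addrAC -/w !mxE addrC.
under [RHS]eq_bigr => i _ do rewrite E mulrDr.
rewrite big_split /= -mulr_suml mulrDr [X in X + _]mulrC; congr (_ + _).
under [RHS]eq_bigr => i _ do rewrite p mulr_suml.
rewrite exchange_big p mulr_sumr; apply: eq_bigr => l _ /=.
transitivity (\sum_k c l * w 0 k * \sum_i rows_mx r i l * cofactor (rows_mx r) i k).
  rewrite (bigD1 l) //= sum_cofactor_col eqxx big1 => [|k kl].
    by rewrite addr0 mulrC [w 0 l * _]mulrC.
  by rewrite sum_cofactor_col (negbTE kl) mulr0.
under eq_bigr => k _ do rewrite mulr_sumr.
rewrite exchange_big; apply: eq_bigr => i _ /=; rewrite mulr_sumr.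
by apply: eq_bigr => k _; rewrite mulrACA mxE [c l * _]mulrC.
Qed.

Lemma E_axioms : nLie_axioms E_bracket.
Proof.
split=> //; apply: nLie_identity_basis => // a r.
have snocE (z : H1) : snoc (fun i => << a i >>) << z >> =
    (fun i => << snoc a z i >>) :> ('I_m.+1 -> {malg K[H1]}).
  by apply: funext => i; rewrite /snoc; case: unliftP.
have updE i (z : H1) : upd (fun i => << r i >>) i << z >> =
    (fun k => << upd r i z k >>) :> ('I_m.+1 -> {malg K[H1]}).
  by apply: funext => k; rewrite /upd; case: eqP.
have b0 (x : 'I_m.+1 -> {malg K[H1]}) i c u :
    E_bracket (upd x i (c *: u)) = c *: E_bracket (upd x i u).
  have /= M := E_multilinear x i; have := M c u 0; rewrite addr0 => ->.
  by have := M (-1) 0 0; rewrite scaler0 addr0 scaleN1r addNr => ->; rewrite addr0.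
have vsnoc (z : H1) : rows_mx (fun i => val (snoc a z i)) =
    rows_mx (snoc (fun i => val (a i)) (val z)).
  by congr rows_mx; apply: funext => i; rewrite /snoc; case: unliftP.
have vupd i (z : H1) : rows_mx (fun k => val (upd r i z k)) =
    rows_mx (upd (fun i => val (r i)) i (val z)).
  by congr rows_mx; apply: funext => k; rewrite /upd; case: eqP.
have sum_snoc (z : H1) : \sum_i val (snoc a z i) = \sum_i val (a i) + val z.
  rewrite big_ord_recr; congr (_ + _) => /=; last by rewrite /snoc unlift_none.
  apply: eq_bigr => i _; rewrite /snoc.
  by have -> : widen_ord (leqnSn m) i = lift ord_max i; [apply: val_inj; rewrite /= /bump leqNgt ltn_ord|rewrite liftK].
have sum_upd i (z : H1) : \sum_k val (upd r i z k) = \sum_k val (r k) - val (r i) + val z.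
  rewrite (bigD1 i) //= [in RHS](bigD1 i) //= /upd eqxx.
  rewrite [X in X - _]addrC addrK addrC; congr (_ + _); apply: eq_bigr => k ki.
  by rewrite (negbTE ki).
rewrite E_bracket_basis (snoc_upd_max _ 0) b0 -snoc_upd_max snocE E_bracket_basis.
under eq_bigr => i _.
  rewrite snocE E_bracket_basis b0 updE E_bracket_basis scalerA.
  rewrite (_ : E_index (upd r i _) = E_index (snoc a (E_index r))).
    over.
  apply: val_inj; rewrite /= sum_upd sum_snoc /= sum_snoc.
  congr (_ + _); rewrite [_ + val (r i)]addrC -[val (r i) + _ + t1]addrA.
  by rewrite [LHS]addrA subrK addrCA.
rewrite -scaler_suml scalerA; congr (_ *: _).
rewrite vsnoc /= det_identity; apply: eq_bigr => i _.
by rewrite vsnoc vupd /= sum_snoc.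
Qed.

Definition E : nLieAlg K m := NLieAlg E_axioms.

End EAlgebra.

(* Main.v *)
Require Import Defs.
From HB Require Import structures.
From mathcomp Require Import all_boot all_order all_algebra.
From mathcomp Require Import boolp classical_sets reals.
From mathcomp Require Import complex finmap monalg.
From mathcomp Require Import ring.

Import GRing.Theory Num.Theory.
Local Open Scope ring_scope.

(* Fix u in H_1. The slice H_1 is an abelian group for a +_u b = a + b - u, with
   neutral element u; A is its group algebra, so that A and E(H) have the same
   basis e_a. The coordinates l_i(a) = a_(i+1) - u_(i+1) are additive, hence
   d_i(e_a) = l_i(a) e_a are commuting derivations. The bracket of W(A, <d_i>) has
   the right determinants, but it lands in e_(a_1 + ... + a_n - m u) instead of
   e_(a_1 + ... + a_n + t_1). Multiplying d_1 alone by the invertible monomial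
   e_w, w = n u + t_1, repairs this, and the span g of e_w d_1, d_2, ..., d_m is
   still a Lie algebra because [d_i, e_w d_1] = l_i(w) e_w d_1. A g-invariant ideal
   is invariant under all d_i, which separate the monomials, so it is spanned by
   monomials, and these are invertible. *)

(* Locked so that unification does not unfold products in the group algebra. *)
HB.lock Definition linear_extension (K : fieldType) (I : choiceType)
    (L : lmodType K) (f : I -> L) (x : {malg K[I]}) : L :=
  \sum_(a <- msupp x) x@_a *: f a.
Canonical linear_extension_unlockable := Unlockable linear_extension.unlock.
Arguments linear_extension {K I L} f x.

(** * Linear maps out of a free module, prescribed on its basis *)

Section LinearExtension.
Context {K : fieldType} {I : choiceType} {L : lmodType K}.
Implicit Types (f : I -> L) (x : {malg K[I]}).

Lemma monalgZE x : x = \sum_(a <- msupp x) x@_a *: << a >>.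
Proof.
rewrite {1}[x]monalgE; apply: eq_bigr => a _.
by apply/malgP => b; rewrite mcoeffZ !mcoeffU mulr_natr.
Qed.

Lemma linear_malg_ext (F G : {linear {malg K[I]} -> L}) :
  (forall a, F << a >> = G << a >>) -> F =1 G.
Proof.
move=> FG x; rewrite [x]monalgZE !linear_sum.
by apply: eq_bigr => a _; rewrite !linearZ FG.
Qed.

(** Terms outside the support vanish; a set [T] common to several arguments makes linearity a
    termwise check. *)
Lemma linear_extensionEw f x (T : {fset I}) : (msupp x `<=` T)%fset ->
  linear_extension f x = \sum_(a <- T) x@_a *: f a.
Proof.
rewrite unlock => xT; apply: (big_fset_incl _ xT) => a _ /mcoeff_outdom ->.
by rewrite scale0r.
Qed.

Fact linear_extension_is_linear f : linear (linear_extension f).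
Proof.
move=> c x y; pose T := (msupp x `|` msupp y `|` msupp (c *: x + y))%fset.
rewrite !(@linear_extensionEw _ _ T) ?scaler_sumr -?big_split /=;
  try by apply/fsubsetP => a ax; rewrite !inE ax ?orbT.
by apply: eq_bigr => a _; rewrite mcoeffD mcoeffZ scalerDl scalerA.
Qed.

HB.instance Definition _ f := GRing.isLinear.Build K {malg K[I]} L *:%R
  (linear_extension f) (linear_extension_is_linear f).

Lemma linear_extensionU f a : linear_extension f << a >> = f a.
Proof.
rewrite (@linear_extensionEw _ _ [fset a]%fset) ?msuppU_le //.
by rewrite big_seq_fset1 mcoeffUU scale1r.
Qed.

End LinearExtension.

(** * The group algebra of an abelian group *)

(** An alias, so that the product can come from the addition of [V] while the underlying module
    remains the one that carries E(H). *)
Definition group_algebra (K : fieldType) (V : zmodType) : Type := {malg K[V]}.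

HB.instance Definition _ K V := GRing.Lmodule.on (group_algebra K V).

Section GroupAlgebra.
Variables (K : fieldType) (V : zmodType).
Local Notation A := (group_algebra K V).
Implicit Types (x y z : A) (a b : V).

Definition gexp a : A := << a >>.

Lemma linear_gexp_ext (L : lmodType K) (F G : {linear A -> L}) :
  (forall a, F (gexp a) = G (gexp a)) -> F =1 G.
Proof. exact: linear_malg_ext. Qed.

Definition gmul x y : A :=
  linear_extension (fun a => linear_extension (fun b => gexp (a + b)) y) x.

(** Exchanging the two finite sums makes linearity in the right factor visible as well. *)
Lemma gmulEr x y :
  gmul x y = linear_extension (fun b => linear_extension (fun a => gexp (a + b)) x) y.
Proof.
rewrite /gmul unlock.
under eq_bigr do rewrite scaler_sumr.
rewrite exchange_big /=; apply: eq_bigr => b _; rewrite scaler_sumr.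
by apply: eq_bigr => a _; rewrite !scalerA mulrC.
Qed.

(** With the left factor as variable this is a linear map too, so identities between products need
    checking on monomials only. *)
Definition gmull y x : A := gmul x y.

Fact gmull_is_linear y : linear (gmull y).
Proof. exact: linear_extension_is_linear. Qed.

Fact gmulr_is_linear x : linear (gmul x).
Proof. by move=> c y z; rewrite !gmulEr linearP. Qed.

HB.instance Definition _ y :=
  GRing.isLinear.Build K A A *:%R (gmull y) (gmull_is_linear y).
HB.instance Definition _ x :=
  GRing.isLinear.Build K A A *:%R (gmul x) (gmulr_is_linear x).

Lemma gexpM a b : gmul (gexp a) (gexp b) = gexp (a + b).
Proof. by rewrite /gmul /gexp !linear_extensionU. Qed.

Fact gmulC : commutative gmul.
Proof.
move=> x y; apply: (linear_gexp_ext _ (gmull y) (gmul y)) => a /=.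
apply: (linear_gexp_ext _ (gmul (gexp a)) (gmull (gexp a))) => b /=.
by rewrite /gmull !gexpM addrC.
Qed.

Fact gmulA : associative gmul.
Proof.
move=> x y z.
apply: (linear_gexp_ext _ (gmull (gmul y z)) (gmull z \o gmull y)) => a /=.
apply: (linear_gexp_ext _ (gmul (gexp a) \o gmull z) (gmull z \o gmul (gexp a))) => b /=.
apply: (linear_gexp_ext _ (gmul (gexp a) \o gmul (gexp b)) (gmul (gmul (gexp a) (gexp b)))) => c /=.
by rewrite /gmull !gexpM addrA.
Qed.

Fact gmul1 : left_id (gexp 0) gmul.
Proof.
by move=> x; apply: (linear_gexp_ext _ (gmul (gexp 0)) idfun) => a; rewrite /= gexpM add0r.
Qed.

Fact gmulDl : left_distributive gmul +%R.
Proof. by move=> x y z; exact: (linearD (gmull z)). Qed.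

Fact gexp0_neq0 : gexp 0 != 0.
Proof. by rewrite monalgU_eq0 oner_eq0. Qed.

HB.instance Definition _ := GRing.Zmodule_isComNzRing.Build A
  gmulA gmulC gmul1 gmulDl gexp0_neq0.

Fact gscaleAl c x y : c *: (x * y) = (c *: x) * y.
Proof. by apply/esym; exact: (linearZ_LR (gmull y) c x). Qed.

HB.instance Definition _ := GRing.Lmodule_isLalgebra.Build K A gscaleAl.
HB.instance Definition _ := GRing.Lalgebra_isComAlgebra.Build K A.

Lemma gmulE x y : gmul x y = x * y. Proof. by []. Qed.

Lemma gexpD a b : gexp (a + b) = gexp a * gexp b.
Proof. by rewrite -gexpM. Qed.

Lemma gexp0 : gexp 0 = 1. Proof. by []. Qed.

Lemma gexp_sum (J : finType) (v : J -> V) :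
  \prod_j gexp (v j) = gexp (\sum_j v j).
Proof. by rewrite (big_morph gexp gexpD gexp0). Qed.

End GroupAlgebra.

Arguments gexp {K V} a.
Arguments gmul {K V} x y.
Arguments gmull {K V} y x.

(** * Derivations that shift monomials *)

Section MonomialDerivations.
Context {K : fieldType} {V : zmodType}.
Local Notation A := (group_algebra K V).
Implicit Types (x y : A) (a b w : V) (l : {additive V -> K}).

(** This is e_w d_l, where d_l is the diagonal derivation e_a -> l(a) e_a. *)
Definition gder l w : A -> A :=
  linear_extension (fun a => l a *: gexp (a + w)).

HB.instance Definition _ l w := GRing.Linear.on (gder l w).

Lemma gderU l w a : gder l w (gexp a) = l a *: gexp (a + w).
Proof. exact: linear_extensionU. Qed.

Lemma gderM l w x y : gder l w (x * y) = gder l w x * y + x * gder l w y.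
Proof.
apply: (linear_gexp_ext _ _ _ (gder l w \o gmull y)
  ((gmull y \o gder l w) \+ gmull (gder l w y))) => a /=.
apply: (linear_gexp_ext _ _ _ (gder l w \o gmul (gexp a))
  (gmul (gder l w (gexp a)) \+ (gmul (gexp a) \o gder l w))) => b /=.
rewrite gexpM !gderU.
rewrite /gmull !gmulE -scalerAl -scalerAr -!gexpD raddfD scalerDl.
by rewrite [a + w + b]addrAC [a + (b + w)]addrA.
Qed.

Lemma gder_shift l w x : gder l w x = gexp w * gder l 0 x.
Proof.
apply: (linear_gexp_ext _ _ _ (gder l w) (gmul (gexp w) \o gder l 0)) => a /=.
rewrite !gderU gmulE -scalerAr -gexpD.
by rewrite addr0 addrC.
Qed.

Lemma mcoeff_gder l x a : (gder l 0 x)@_a = l a * x@_a.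
Proof.
rewrite /gder unlock raddf_sum /= [in RHS](monalgZE x) raddf_sum mulr_sumr /=.
apply: eq_bigr => b _; rewrite addr0 !mcoeffZ mcoeffU.
by have [->|_] := eqVneq b a; rewrite ?mulr0 ?mulr1 // mulrC.
Qed.

(** On e_a the terms in l(a) l'(a) cancel. Keeping e_w and e_w' as outer factors shows when the
    result is a combination of the two derivations themselves. *)
Lemma gder_bracket l l' w w' x :
  gder l w (gder l' w' x) - gder l' w' (gder l w x) =
  gexp w * (l w' *: gder l' w' x) - gexp w' * (l' w *: gder l w x).
Proof.
apply: (linear_gexp_ext _ _ _ ((gder l w \o gder l' w') \- (gder l' w' \o gder l w))
  ((gmul (gexp w) \o (l w' \*: gder l' w')) \- (gmul (gexp w') \o (l' w \*: gder l w)))) => a /=.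
rewrite !gderU !linearZ /= !gderU !gmulE -!gexpD !raddfD !scalerN /= !scalerA.
rewrite [w + _]addrC [w' + _]addrC [a + w + w']addrAC -!scalerBl; congr (_ *: _).
by ring.
Qed.

End MonomialDerivations.

(** * The Lie algebra spanned by a finite family of derivations *)

Section DerivationSpan.
Context {K : numFieldType} {A : comAlgType K} {m : nat}.
Variable D : 'I_m -> A -> A.

Definition der_span : set (A -> A) :=
  [set d | exists c : 'I_m -> K, forall x, d x = \sum_i c i *: D i x]%classic.

Lemma der_span_mem i : der_span (D i).
Proof.
exists (fun j => (j == i)%:R) => x; rewrite (bigD1 i) //= eqxx scale1r.
by rewrite big1 ?addr0 // => j /negbTE ->; rewrite scale0r.
Qed.

Lemma der_span0 : der_span (fun=> 0).
Proof. by exists (fun=> 0) => x; rewrite big1 // => i _; rewrite scale0r. Qed.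

Lemma der_span_lin a d d' : der_span d -> der_span d' ->
  der_span (fun x => a *: d x + d' x).
Proof.
move=> [c dE] [c' dE']; exists (fun i => a * c i + c' i) => x.
rewrite dE dE' scaler_sumr -big_split; apply: eq_bigr => i _ /=.
by rewrite scalerDl scalerA.
Qed.

Lemma der_span_scaleB a b i j : der_span (fun x => a *: D i x - b *: D j x).
Proof.
have -> : (fun x => a *: D i x - b *: D j x) =
    (fun x => a *: D i x + (- b *: D j x + 0)).
  by apply: funext => x; rewrite addr0 scaleNr.
apply: der_span_lin; first exact: der_span_mem.
by apply: der_span_lin; [exact: der_span_mem|exact: der_span0].
Qed.

Lemma der_span_sum n (F : 'I_n -> A -> A) : (forall i, der_span (F i)) ->
  der_span (fun x => \sum_i F i x).
Proof.
move=> FS; have /choice[c FE] : forall i, exists c : 'I_m -> K,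
    forall x, F i x = \sum_j c j *: D j x by [].
exists (fun j => \sum_i c i j) => x.
under eq_bigr do rewrite FE; rewrite exchange_big; apply: eq_bigr => j _.
by rewrite scaler_suml.
Qed.

Hypothesis D_der : forall i, derivation (D i).

Lemma der_span_derivation d : der_span d -> derivation d.
Proof.
case=> c dE; split=> [a x y|x y]; rewrite /= !dE.
  rewrite scaler_sumr -big_split; apply: eq_bigr => i _ /=.
  by have /= -> := (D_der i).1 a x y; rewrite scalerDr !scalerA mulrC.
rewrite mulr_suml mulr_sumr -big_split; apply: eq_bigr => i _ /=.
by rewrite (D_der i).2 scalerDr scalerAl scalerAr.
Qed.

Hypothesis D_bracket : forall i j, der_span (fun x => D i (D j x) - D j (D i x)).

(** The commutator is bilinear, so closure reduces to the brackets of the spanning derivations. *)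
Lemma der_span_lie : is_lie_subalgebra_Der der_span.
Proof.
split; [exact: der_span_derivation|exact: der_span0|exact: der_span_lin|].
move=> d d' [c dE] [c' dE'].
have -> : (fun x => d (d' x) - d' (d x)) =
    (fun x => \sum_i \sum_j (c i * c' j) *: (D i (D j x) - D j (D i x))).
  apply: funext => x; rewrite dE dE' dE dE'.
  have DD (a b : 'I_m -> K) : \sum_i a i *: D i (\sum_j b j *: D j x) =
      \sum_i \sum_j (a i * b j) *: D i (D j x).
    apply: eq_bigr => i _.
    pose L := HB.pack_for {linear A -> A} (D i)
      (GRing.isLinear.Build _ _ _ _ (D i) (D_der i).1).
    have /= -> := linear_sum L _ _ _; rewrite scaler_sumr.
    by apply: eq_bigr => j _; have /= -> := linearZ_LR L _ _; rewrite scalerA.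
  rewrite !DD [X in _ - X]exchange_big -sumrB; apply: eq_bigr => i _.
  rewrite -sumrB; apply: eq_bigr => j _.
  by rewrite scalerBr [c' j * _]mulrC.
apply: der_span_sum => i; apply: der_span_sum => j.
have [e eE] := D_bracket i j; exists (fun p => c i * c' j * e p) => x.
by rewrite eE scaler_sumr; apply: eq_bigr => p _; rewrite scalerA.
Qed.

End DerivationSpan.

(** * The W-type algebra of the derivations e_(w_i) d_i *)

Section WTypeGroupAlgebra.
Context {K : numFieldType} {V : zmodType} {m : nat}.
Variables (l : 'I_m -> {additive V -> K}) (w : 'I_m -> V).
Local Notation A := (group_algebra K V).

Definition gder_family (i : 'I_m) : A -> A := gder (l i) (w i).
Local Notation D := gder_family.

Definition gder_span : set (A -> A) := der_span D.

Hypothesis l_w : forall i j, i != j -> l i (w j) = 0 \/ w i = 0.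

(** Each term of the commutator has a coefficient l_p(w_q) and an extra factor e_(w_p); by [l_w]
    either the coefficient is 0 or the factor is 1. *)
Lemma gder_family_bracket i j x :
  D i (D j x) - D j (D i x) = l i (w j) *: D j x - l j (w i) *: D i x.
Proof.
have [->|ij] := eqVneq i j; first by rewrite !subrr.
have lwE p q y : p != q -> gexp (w p) * (l p (w q) *: y) = l p (w q) *: y.
  by case/l_w => ->; rewrite ?scale0r ?mulr0 // gexp0 mul1r.
by rewrite /D gder_bracket !lwE // eq_sym.
Qed.

Lemma gder_span_lie : is_lie_subalgebra_Der gder_span.
Proof.
apply: der_span_lie => [i|i j]; first by split; [exact: linearP|exact: gderM].
have -> : (fun x => D i (D j x) - D j (D i x)) =
    (fun x => l i (w j) *: D j x - l j (w i) *: D i x).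
  by apply: funext => x; exact: gder_family_bracket.
exact: der_span_scaleB.
Qed.

Hypothesis l_free : forall c : 'I_m -> K,
  (forall a, \sum_i c i * l i a = 0) -> forall i, c i = 0.

(* The sum of the coefficients of a combination of the D i at e^a is the
   same combination of the l i a, whatever the shifts w i. *)
Lemma gder_family_basis : is_basis_of gder_span D.
Proof.
split=> [i|c cD|//]; first exact: der_span_mem.
apply: l_free => a; pose aug : {linear A -> K^o} := linear_extension (fun=> 1).
have augE i : aug (D i (gexp a)) = l i a.
  by rewrite /D gderU linearZ_LR /aug /= linear_extensionU /GRing.scale /= mulr1.
rewrite -[RHS](linear0 aug) -(cD (gexp a)) (linear_sum aug).
by apply: eq_bigr => i _; rewrite (linearZ_LR aug) augE.
Qed.

Hypothesis l_sep : forall a b, (forall i, l i a = l i b) -> a = b.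

Section Ideal.
Variable I : set A.
Hypotheses (I_ideal : is_ideal I) (I_inv : forall d x, gder_span d -> I x -> I (d x)).

(** Multiplying by the unit e_(-w_i) undoes the shift. *)
Lemma ideal_gder0 i x : I x -> I (gder (l i) 0 x).
Proof.
move=> Ix; have -> : gder (l i) 0 x = gexp (- w i) * D i x.
  by rewrite /D [gder _ (w i) _]gder_shift mulrA -gexpD addNr mul1r.
by apply: (ideal_mul I_ideal); apply: I_inv => //; apply: der_span_mem.
Qed.

(** Induction on the size of the support, which shrinks until one monomial is left. *)
Lemma ideal_monomial x : I x -> x != 0 -> exists a, I (gexp a).
Proof.
have [n] := ubnP #|` msupp x|; elim: n x => // n IHn x /ltnSE xn Ix x0.
have [a ax] : exists a, a \in msupp x.
  apply/fset0Pn; apply: contraNneq x0 => x0.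
  by rewrite [x]monalgZE x0 big_seq_fset0.
have [[b bx ba]|xa] := pselect (exists2 b, b \in msupp x & b != a).
  have [i lab] : exists i, l i b != l i a.
    apply: contrapT => H; case/eqP: ba; apply: l_sep => i.
    by apply: contrapT => /eqP lab; case: H; exists i.
  (* The operator d_i - l_i(a) scales the coefficient at c by l_i(c) - l_i(a): it removes a from the
     support, adds nothing and keeps b. *)
  pose y : A := - l i a *: x + gder (l i) 0 x.
  have yE c : y@_c = (l i c - l i a) * x@_c.
    by rewrite mcoeffD mcoeffZ mcoeff_gder -mulrDl addrC.
  apply: (IHn y).
  - apply: leq_trans xn; apply: fproper_ltn_card; rewrite fproperE.
    apply/andP; split; last first.
      by apply/fsubsetPn; exists a => //; rewrite -mcoeff_eq0 yE subrr mul0r.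
    by apply/fsubsetP => c; rewrite -!mcoeff_neq0 yE mulf_eq0 negb_or => /andP[].
  - by apply: (ideal_lin I_ideal) => //; apply: ideal_gder0.
  apply: contraNneq lab => y0; have := yE b; rewrite y0 mcoeff0 => /esym/eqP.
  by rewrite mulf_eq0 subr_eq0 mcoeff_eq0 bx orbF.
exists a; have xE : x = x@_a *: gexp a.
  apply/malgP => b; rewrite mcoeffZ mcoeffU.
  have [<-|ba] := eqVneq a b; first by rewrite mulr1.
  rewrite mulr0; apply: mcoeff_outdom; apply/negP => bx.
  by apply: xa; exists b => //; rewrite eq_sym.
have -> : gexp a = (x@_a)^-1 *: x + 0.
  by rewrite addr0 {2}xE scalerA mulVf ?scale1r // mcoeff_neq0.
by apply: (ideal_lin I_ideal) => //; apply: (ideal_0 I_ideal).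
Qed.

End Ideal.

Lemma gder_span_simple : g_simple gder_span.
Proof.
move=> I I_ideal I_inv.
have [I0|] := pselect (forall x, I x -> x = 0); [by left|].
move=> /existsNP[x /not_implyP[Ix /eqP x0]]; right => y.
have [a Ia] := ideal_monomial _ I_ideal I_inv _ Ix x0.
have -> : y = y * gexp (- a) * gexp a.
  by rewrite -mulrA -gexpD addNr mulr1.
exact: (ideal_mul I_ideal).
Qed.

(** Each matrix entry is a scalar times a monomial of its row times a monomial of its column, so the
    matrix is a scalar matrix of numbers between two diagonal ones. *)
Lemma W_bracket_gexp (a : 'I_m.+1 -> V) :
  W_bracket D (fun j => gexp (a j)) =
  \det (\matrix_(k < m.+1, j < m.+1) oapp (fun i => l i (a j)) 1 (unlift ord0 k))
    *: gexp (\sum_j a j + \sum_i w i).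
Proof.
(* The row of undifferentiated entries has shift 0. *)
pose v (k : 'I_m.+1) := oapp w 0 (unlift ord0 k).
set L : 'M[K]_m.+1 := \matrix_(k, j) _.
have -> : W_bracket D (fun j => gexp (a j)) =
    \det (diag_mx (\row_k gexp (v k)) *m map_mx (in_alg A) L
          *m diag_mx (\row_j gexp (a j))).
  congr (\det _); apply/matrixP => k j; rewrite mul_mx_diag mul_diag_mx !mxE.
  rewrite /jet /v; case: unliftP => [i _|_] /=.
    by rewrite /D gderU mulr_algr -scalerAl -gexpD addrC.
  by rewrite gexp0 scale1r !mul1r.
rewrite !det_mulmx !det_diag det_map_mx.
under eq_bigr do rewrite mxE; under [X in _ * X]eq_bigr do rewrite mxE.
rewrite !gexp_sum mulr_algr -scalerAl -gexpD addrC; congr (_ *: gexp (_ + _)).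
rewrite big_ord_recl /v unlift_none add0r; apply: eq_bigr => i _.
by rewrite liftK.
Qed.

End WTypeGroupAlgebra.

(** * The slice H_1 as an abelian group with base point u *)

Section BasedSlice.
Context {K : numFieldType} {m : nat} {H : zmodClosed 'rV[K]_m.+1}.

Definition based_H1 (u : H1 H) : Type := H1 H.

HB.instance Definition _ u := Choice.on (based_H1 u).

Variable u : H1 H.
Local Notation V := (based_H1 u).
Implicit Types a b c : V.

Fact based_add_subproof a b :
  let s := val a + val b - val u in (s \in H) && (s 0 ord0 == 1).
Proof.
case: a b => a /= /andP[aH /eqP a1] [b /= /andP[bH /eqP b1]].
have /andP[uH /eqP u1] := valP u.
by rewrite rpredB ?rpredD //= !mxE a1 b1 u1 addrK.
Qed.

Fact based_opp_subproof a :
  let s := val u + val u - val a in (s \in H) && (s 0 ord0 == 1).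
Proof.
have /andP[uH /eqP u1] := valP u; have /andP[aH /eqP a1] := valP a.
by rewrite /= rpredB ?rpredD //= !mxE a1 u1 addrK.
Qed.

Definition based_add a b : V := exist _ (val a + val b - val u) (based_add_subproof a b).
Definition based_opp a : V := exist _ (val u + val u - val a) (based_opp_subproof a).

Fact based_addA : associative based_add.
Proof.
move=> a b c; apply: val_inj; rewrite /= !addrA; congr (_ - _).
by rewrite addrAC.
Qed.

Fact based_addC : commutative based_add.
Proof. by move=> a b; apply: val_inj; rewrite /= [val a + _]addrC. Qed.

Fact based_add0 : left_id (u : V) based_add.
Proof. by move=> a; apply: val_inj; rewrite /= [_ + val a]addrC addrK. Qed.

Fact based_addN : left_inverse (u : V) based_opp based_add.
Proof. by move=> a; apply: val_inj; rewrite /= subrK addrK. Qed.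

HB.instance Definition _ := GRing.isZmodule.Build V
  based_addA based_addC based_add0 based_addN.

(** Translation by -u turns the addition based at [u] into the addition of vectors. *)
Definition based_vec a : 'rV[K]_m.+1 := sval a - val u.

Fact based_vec_is_additive : {morph based_vec : a b / a - b}.
Proof.
by move=> a b; apply/rowP => k; rewrite !mxE; ring.
Qed.

HB.instance Definition _ :=
  GRing.isZmodMorphism.Build V 'rV[K]_m.+1 based_vec based_vec_is_additive.

Lemma based_vec_inj : injective based_vec.
Proof. by move=> a b /addIr /val_inj. Qed.

Definition based_coord (i : 'I_m) a : K := based_vec a 0 (lift ord0 i).

Fact based_coord_is_additive i : {morph based_coord i : a b / a - b}.
Proof. by move=> a b; rewrite /based_coord raddfB !mxE. Qed.

HB.instance Definition _ i :=
  GRing.isZmodMorphism.Build V K (based_coord i) (based_coord_is_additive i).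

Lemma based_vec0 a : based_vec a 0 ord0 = 0.
Proof.
have /andP[_ /eqP a1] := valP a; have /andP[_ /eqP u1] := valP u.
by rewrite !mxE u1 /= a1 subrr.
Qed.

(** On the slice a - u has coordinate 0 equal to zero, so the other m coordinates determine a. *)
Lemma based_coord_inj a b : (forall i, based_coord i a = based_coord i b) -> a = b.
Proof.
move=> ab; apply: based_vec_inj; apply/rowP => k.
by case: (unliftP ord0 k) => [i ->|->]; [exact: ab | rewrite !based_vec0].
Qed.

(** A relation among the coordinates is an affine equation on H_1. As a_1 = 1 there, it becomes a
    linear form that vanishes on n independent vectors. *)
Lemma based_coord_free (h : 'I_m.+1 -> H1 H) (c : 'I_m -> K) :
  row_free (rows_mx (fun i => val (h i))) ->
  (forall a, \sum_i c i * based_coord i a = 0) -> forall i, c i = 0.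
Proof.
move=> hfree c0 i.
(* Entry 0 meets the coordinate 1 of each [h j] and so accounts for the translation by -u. *)
pose z : 'cV[K]_m.+1 := \col_k oapp c (- \sum_i c i * val u 0 (lift ord0 i)) (unlift ord0 k).
have : rows_mx (fun i => val (h i)) *m z = 0.
  apply/colP => j; rewrite !mxE big_ord_recl !mxE unlift_none /=.
  have /andP[_ /eqP ->] := valP (h j); rewrite mul1r addrC.
  rewrite -[RHS](c0 (h j)) -sumrB; apply: eq_bigr => k _.
  by rewrite !mxE liftK /= /based_coord !mxE mulrBr mulrC.
move=> /(congr1 (mulmx (invmx (rows_mx (fun i => val (h i)))))).
rewrite mulmx0 mulKmx -?row_free_unit // => /colP /(_ (lift ord0 i)).
by rewrite !mxE liftK.
Qed.

(* Row 0 of [rows_mx a]^T is constant equal to 1, and subtracting multiples of it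
   from the other rows turns a_j into a_j - u there. *)
Lemma det_based_coord (a : 'I_m.+1 -> V) :
  \det (\matrix_(k, j) oapp (based_coord ^~ (a j)) 1 (unlift ord0 k)) =
  \det (rows_mx (fun j => val (a j))).
Proof.
pose T : 'M[K]_m.+1 :=
  \matrix_(k, k') ((k == k')%:R - ((k != ord0) && (k' == ord0))%:R * val u 0 k).
have T1 : \det T = 1.
  rewrite det_trig.
    rewrite big1 // => k _; rewrite mxE eqxx.
    by case: (k == ord0); rewrite mul0r subr0.
  apply/is_trig_mxP => k k' kk'; rewrite mxE.
  have [k0|_] := eqVneq k' ord0; first by rewrite k0 in kk'.
  have [kk|_] := eqVneq k k'; first by rewrite kk ltnn in kk'.
  by rewrite andbF mul0r subr0.
rewrite -[RHS]det_tr -[RHS]mul1r -[X in _ = X * _]T1 -det_mulmx.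
congr (\det _).
apply/matrixP => k j; rewrite !mxE.
have a1 : val (a j) 0 ord0 = 1 by have /andP[_ /eqP] := valP (a j).
transitivity (\sum_k' ((k == k')%:R * val (a j) 0 k' -
    ((k != ord0) && (k' == ord0))%:R * val u 0 k * val (a j) 0 k')); last first.
  by apply: eq_bigr => k' _; rewrite !mxE mulrBl.
rewrite sumrB (bigD1 k) //= eqxx mul1r big1 ?addr0; last first.
  by move=> k' /negbTE; rewrite eq_sym => ->; rewrite mul0r.
rewrite (bigD1 ord0) //= a1 eqxx andbT mulr1 big1 ?addr0; last first.
  by move=> k' /negbTE ->; rewrite andbF !mul0r.
case: unliftP => [i ->|->] /=; last by rewrite mul0r subr0.
by rewrite /based_coord !mxE mul1r.
Qed.

Hypothesis Ht1 : t1 K m \in H.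

(** The value at index 0 is w = n u + t_1; elsewhere it is [u], the zero of the group, which means
    no shift. *)
Definition based_shift (i : 'I_m) : V :=
  if i == 0%N :> nat then E_index Ht1 (fun=> u) else u.

Lemma based_coord_shift i j : i != j ->
  based_coord i (based_shift j) = 0 \/ based_shift i = 0.
Proof.
rewrite /based_shift => ij.
case: eqP => [j0|_]; last by left; exact: (raddf0 (based_coord i)).
case: eqP => [i0|_]; last by right.
by case/eqP: ij; apply: ord_inj; rewrite i0 j0.
Qed.

(** The shifts add up to the one at index 0, which exists since [0 < m]. As vectors relative to u,
    both sides are a_1 + ... + a_n + t_1 - u. *)
Lemma E_index_based (a : 'I_m.+1 -> V) : (0 < m)%N ->
  E_index Ht1 a = \sum_j a j + \sum_i based_shift i :> V.
Proof.
move=> m0; have -> : \sum_i based_shift i = E_index Ht1 (fun=> u) :> V.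
  rewrite (bigD1 (Ordinal m0)) //= big1 ?addr0 // => i i0.
  by rewrite /based_shift -val_eqE /= in i0 *; rewrite (negbTE i0).
apply: based_vec_inj; rewrite raddfD raddf_sum.
rewrite /based_vec /= sumrB addrA; congr (_ - _).
by rewrite addrA subrK.
Qed.

End BasedSlice.

(** * The isomorphism between E(H) and W(A, g) *)

Theorem proposition8p1 (R : realType) (m : nat) (n_ge3 : (3 <= m.+1)%N)
    (H : zmodClosed 'rV[R[i]]_m.+1) (Ht1 : t1 R[i] m \in H)
    (H1_indep : exists h : 'I_m.+1 -> H1 H,
       row_free (rows_mx (fun i => val (h i)))) :
  exists (A : comAlgType R[i]) (g : set (A -> A))
    (hg : is_lie_subalgebra_Der g)
    (D : 'I_m -> A -> A) (hD : is_basis_of g D),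
    g_simple g /\ nLie_isomorphic (E Ht1) (W hg hD).
Proof.
have [h hfree] := H1_indep; pose u := h ord0.
pose l i : {additive based_H1 u -> R[i]} := based_coord u i.
pose w := based_shift u Ht1.
have hg := gder_span_lie l w (based_coord_shift u Ht1).
have hD := gder_family_basis l w (fun c => based_coord_free u h c hfree).
exists (group_algebra R[i] (based_H1 u)), _, hg, _, hD.
split; first exact: gder_span_simple (based_coord_inj u).
(* Both spaces are free on H_1, and e_a is sent to e_a. *)
exists (idfun : {linear {malg R[i][H1 H]} -> {malg R[i][H1 H]}}).
split; first by exists idfun.
move=> x; apply/eqP; rewrite -subr_eq0; apply/eqP.
(* Both brackets are multilinear, so they are compared on basis vectors. *)
apply: (@multilinear_ext0 _ _ _ _ (fun x => E_bracket Ht1 x - W_bracket (gder_family l w) x)).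
  apply: multilinear_sub; first exact: nLie_multilinear (E_axioms Ht1).
  exact: W_multilinear hg hD.
move=> a; rewrite E_bracket_basis; apply/eqP; rewrite subr_eq0; apply/eqP.
rewrite [RHS](W_bracket_gexp l w a) (E_index_based u Ht1) -?(det_based_coord u a) //.
by rewrite -ltnS ltnW.
Qed.
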